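(* Let $G\in\mathcal{G}_{k,n,p}$ and $v\neq w\in V(G)$. Then \[ H_{wv}=\frac{2|E(G)|}{d(v)}-1+\frac{2|E(G)|}{d(v)}\cdot\frac{1}{|N(v)|}\sum_{u\in N(v)}\sum_{i=1}^{3k+1}\big(\mathbb{P}_u[X_i=v]-\mathbb{P}_w[X_i=v]\big)\pm\mathcal{O}\!\left(\frac{\sqrt{\log n}}{\sqrt{pn}}\right). \]
   Context: Fix an integer $k\ge2$ and let $p=p(n)$ satisfy $\frac{\log n}{n^{(k-1)/k}}\le p\le 1-\Omega(\frac{\log^4 n}{n})$. $\mathcal{G}_{k,n,p}$ denotes the set of graphs $G$ on $n$ vertices satisfying: (i) $G$ is not bipartite; (ii) $\operatorname{diam}(G)\le k$; (iii) every vertex has degree $d(v)=pn\pm\mathcal{O}(\sqrt{pn\log n})$; (iv) $2|E(G)|=pn^2\pm\mathcal{O}(\sqrt{pn^2\log n})$; (v) $|N(v)\cap N(w)|=p^2n\pm\mathcal{O}(\max\{\sqrt{p^2n\log n},\log n\})$ for all $v\ne w$; (vi) the unit eigenvector $\phi$ of the largest adjacency eigenvalue has entries $\phi_i=\frac1{\sqrt n}\pm\mathcal{O}(\frac{\log^{3/2}n}{\sqrt p\,n\log(pn)})$; (vii) $\lambda_1=(1+o(1))pn$; (viii) $\max\{|\lambda_2|,|\lambda_n|\}=\mathcal{O}(\sqrt{pn})$, where $\lambda_1\ge\dots\ge\lambda_n$ are the adjacency eigenvalues. Asymptotic notation is as $n\to\infty$ with constants independent of $n$. $X=X_0,X_1,\dots$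 is a simple random walk on $G$, $\mathbb{P}_u[\cdot]=\mathbb{P}[\cdot\mid X_0=u]$, $H_{wv}$ is the expected first hitting time of $v$ from $w$, and $N(v)$, $d(v)$ are the neighbourhood and degree of $v$. *)

(* Defs.v *)
From HB Require Import structures.
From mathcomp Require Import all_boot all_order all_algebra.
From mathcomp Require Import all_classical all_reals all_analysis.
Set Implicit Arguments. Unset Strict Implicit. Unset Printing Implicit Defensive.
Import Order.TTheory GRing.Theory Num.Theory.
Local Open Scope ring_scope.

Section Graphs.
Variable R : realType.
Variable n : nat.
Variable e : rel 'I_n.

Definition simple_graph : Prop := (forall x y, e x y = e y x) /\ (forall x, ~~ e x x).

Definition nbhd (v : 'I_n) : {set 'I_n} := [set u | e v u].
Definition deg (v : 'I_n) : nat := #|nbhd v|.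

Definition num_edges : nat := #|[set x : 'I_n * 'I_n | e x.1 x.2 && (x.1 < x.2)%N]|.

Definition bipartite : Prop :=
  exists f : 'I_n -> bool, forall x y, e x y -> f x != f y.

Definition diam_le (k : nat) : Prop :=
  forall x y : 'I_n, exists s : seq 'I_n,
    [/\ path e x s, last x s = y & (size s <= k)%N].

Definition adj : 'M[R]_n := \matrix_(i, j) (e i j)%:R.

Definition trans : 'M[R]_n :=
  \matrix_(i, j) (if e i j then (deg i)%:R^-1 else 0).

Definition walk_prob (i : nat) (u v : 'I_n) : R := (trans ^+ i) u v.

Definition trans_avoid (v : 'I_n) : 'M[R]_n :=
  \matrix_(i, j) (if j == v then 0 else trans i j).

(* P_w[tau_v = t], tau_v = min {t >= 0 : X_t = v} *)
Definition hit_at (w v : 'I_n) (t : nat) : R :=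
  match t with
  | 0 => (w == v)%:R
  | t'.+1 => ((trans_avoid v ^+ t') *m trans) w v
  end.

Definition hitting_time (w v : 'I_n) : \bar R :=
  (\sum_(t <oo) ((t%:R * hit_at w v t)%:E))%E.

(* The class G_{k,n,p}, with all hidden O-constants bounded by C0 and the
   o(1) term in (vii) bounded by eps n. *)
Definition in_class (k : nat) (C0 : R) (eps : nat -> R) (p : R) : Prop :=
  let N := n%:R : R in
  let L := ln N in
  [/\ ~ bipartite /\ diam_le k,
      (forall v, `|(deg v)%:R - p * N| <= C0 * Num.sqrt (p * N * L)),
      `|2 * (num_edges)%:R - p * N ^+ 2| <= C0 * Num.sqrt (p * N ^+ 2 * L),
      (forall v w, v != w ->
         `|(#|nbhd v :&: nbhd w|)%:R - p ^+ 2 * N| <=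
           C0 * Num.max (Num.sqrt (p ^+ 2 * N * L)) L) &
      exists lam : nat -> R,
        [/\ char_poly adj = \prod_(i < n) ('X - (lam i)%:P),
            (forall i j, (i <= j < n)%N -> lam j <= lam i),
            (exists phi : 'cV[R]_n,
               [/\ adj *m phi = lam 0%N *: phi,
                   (\sum_(i < n) phi i 0 ^+ 2 = 1) &
                   forall i, `|phi i 0 - (Num.sqrt N)^-1| <=
                     C0 * (L * Num.sqrt L) / (Num.sqrt p * N * ln (p * N))]),
            `|lam 0%N - p * N| <= eps n * (p * N) &
            Num.max `|lam 1%N| `|lam n.-1| <= C0 * Num.sqrt (p * N)]].

End Graphs.

(* Main.v *)
(* Let [P] be the transition matrix, [d] the degree vector, [pi v = d v / 2|E|] and
   [N = 3k+2].  The hitting time to [v] is the unique solution of [h v = 0],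
   [h = 1 + P h] off [v].  Truncating the fundamental-matrix formula for [h] after [N]
   steps gives exactly the claimed expression, up to an error controlled by a vector
   [x] solving [x = r + P x], where [r = P^N (1 - delta_v / pi v)] and [d . r = 0].
   On the orthogonal complement of [d] the matrix [P] contracts the squared Euclidean
   norm by [rho = O(log n / pn)]: the Perron vector of the adjacency matrix is
   nearly proportional to [d], and all other eigenvalues are [O(sqrt(pn))].  Hence
   [|x|^2 <= 4 |r|^2 = O(rho^N n^2)], and [pn >= n^(1/k) log n] gives
   [rho^(2k) n^2 = O(1)]. *)
Require Import Defs.
From HB Require Import structures.
From mathcomp Require Import all_boot all_order all_algebra.
From mathcomp Require Import complex.
From mathcomp Require Import all_classical all_reals all_analysis.
From mathcomp Require Import ring lra zify.
Import Order.TTheory GRing.Theory Num.Theory.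
Import numFieldNormedType.Exports.
Local Open Scope classical_set_scope.
Local Open Scope ring_scope.

Set Implicit Arguments. Unset Strict Implicit. Unset Printing Implicit Defensive.

(** * Spectral norm bounds for normal and symmetric matrices *)

Local Open Scope sesquilinear_scope.

Lemma sum_norm_sq (C : numClosedFieldType) n (x : 'cV[C]_n) :
  \sum_i `|x i 0| ^+ 2 = (x^t* *m x) 0 0.
Proof. by rewrite mxE; apply: eq_bigr => i _; rewrite !mxE normCK mulrC. Qed.

Lemma unitary_dot (C : numClosedFieldType) n (U : 'M[C]_n) (x z : 'cV[C]_n) :
  U \is unitarymx -> (U *m x)^t* *m (U *m z) = x^t* *m z.
Proof.
move=> Uu; rewrite trmx_mul map_mxM -!mulmxA; congr (_ *m _).
by rewrite -(invmx_unitary Uu) mulKmx // unitarymx_unit.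
Qed.

Lemma char_poly_diag (K : fieldType) n (s : 'rV[K]_n) :
  char_poly (diag_mx s) = \prod_i ('X - (s 0 i)%:P).
Proof.
rewrite char_poly_trig ?diag_mx_is_trig //.
by apply: eq_bigr => i _; rewrite mxE eqxx mulr1n.
Qed.

Lemma char_poly_conj (K : fieldType) n (U B : 'M[K]_n) :
  U \in unitmx -> char_poly (invmx U *m B *m U) = char_poly B.
Proof.
move=> Uu; rewrite /char_poly.
have -> : char_poly_mx (invmx U *m B *m U) =
    map_mx polyC (invmx U) *m char_poly_mx B *m map_mx polyC U.
  rewrite /char_poly_mx !map_mxM mulmxBr mulmxBl; congr (_ - _).
  by rewrite -mulmxA -scalar_mxC mulmxA -map_mxM mulVmx // map_mx1 mul1mx.
rewrite !det_mulmx mulrAC -det_mulmx -map_mxM mulVmx //.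
by rewrite map_mx1 det1 mul1r.
Qed.

(** Diagonalise [A] by a unitary [U]. Since [l 0] is a simple eigenvalue, [U *m phi] lives on a
    single coordinate [i0]. The inner product with [phi] is, up to a unit factor, the [i0]
    coordinate of [U *m g], and every other coordinate is scaled by at most [mu]. *)
Lemma normal_norm_bound (C : numClosedFieldType) n (A : 'M[C]_n) (l : nat -> C)
    (mu : C) (phi g : 'cV[C]_n) :
  A \is normalmx -> char_poly A = \prod_(i < n) ('X - (l i)%:P) ->
  A *m phi = l 0 *: phi -> \sum_i `|phi i 0| ^+ 2 = 1 -> 0 <= mu ->
  (forall i, (0 < i < n)%N -> `|l i| <= mu) ->
  (forall i, (0 < i < n)%N -> l i != l 0) ->
  \sum_i `|(A *m g) i 0| ^+ 2 <=
    `|l 0| ^+ 2 * `|\sum_i (phi i 0)^* * g i 0| ^+ 2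
    + mu ^+ 2 * \sum_i `|g i 0| ^+ 2.
Proof.
case: n A phi g => [|n] A phi g Anormal charA Aphi phi1 mu0 lmu lneq.
  by rewrite [X in X <= _]big_ord0 big_ord0 [X in _ + _ * X]big_ord0 normr0 expr0n !mulr0 addr0.
have Aspec := orthomx_spectralP Anormal.
set U := spectralmx A in Aspec; set s := spectral_diag A in Aspec.
have Uunitary : U \is unitarymx by exact: spectral_unitarymx.
have Uunit := unitarymx_unit Uunitary.
have UA z : U *m (A *m z) = diag_mx s *m (U *m z).
  by rewrite {1}Aspec !mulmxA mulmxV // mul1mx.
(* Two factorisations of the same characteristic polynomial into linear factors have the same roots
   with multiplicity. *)
have ps : perm_eq [seq s 0 i | i <- enum 'I_n.+1] [seq l (val i) | i <- enum 'I_n.+1].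
  apply: prod_XsubC_eq; rewrite [LHS]big_map [RHS]big_map !big_enum /= -charA -char_poly_diag.
  by rewrite Aspec char_poly_conj.
have diagE (z : 'cV[C]_n.+1) i : (diag_mx s *m z) i 0 = s 0 i * z i 0.
  by rewrite mul_diag_mx mxE.
pose f := U *m phi; pose y := U *m g.
have sf i : s 0 i * f i 0 = l 0 * f i 0.
  by rewrite -diagE -UA Aphi -scalemxAr mxE.
have f1 : \sum_i `|f i 0| ^+ 2 = 1 by rewrite sum_norm_sq unitary_dot // -sum_norm_sq.
have [i0 si0 suniq] : exists2 i0, s 0 i0 = l 0 & forall i, i != i0 -> s 0 i != l 0 /\ `|s 0 i| <= mu.
  (* Simplicity of [l 0] is transported along [ps] by counting occurrences; a second index with this
     value would make the count at least 2. *)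
  have cnt : count_mem (l 0) [seq s 0 i | i <- enum 'I_n.+1] = 1%N.
    rewrite (permP ps) enum_ordSl /= eqxx count_map add1n.
    apply/eqP; rewrite eqSS -leqn0 leqNgt -has_count; apply/hasP; case=> i.
    rewrite -map_comp => /mapP[j _ ->] /=; apply/negP/lneq; exact: (ltn_ord (lift ord0 j)).
  have : l 0 \in [seq s 0 i | i <- enum 'I_n.+1] by rewrite -has_pred1 has_count cnt.
  case/mapP => i0 _ si0; exists i0 => // i ii0.
  have sil : s 0 i != l 0.
    apply/eqP => si; move: cnt; rewrite count_map -sum1_count big_enum_cond /=.
    rewrite (bigD1 i0) /= -?si0 ?eqxx // (bigD1 i) /=; last by rewrite si si0 eqxx ii0.
    by [].
  split=> //; have : s 0 i \in [seq s 0 i | i <- enum 'I_n.+1] by apply: map_f; rewrite mem_enum.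
  rewrite (perm_mem ps) => /mapP[j _ sj]; rewrite sj; apply: lmu.
  rewrite ltn_ord andbT lt0n; apply: contra sil => /eqP j0.
  by rewrite sj j0.
have f0 i : i != i0 -> f i 0 = 0.
  move=> /suniq[sl _]; apply/eqP; have /eqP := sf i.
  by rewrite -subr_eq0 -mulrBl mulf_eq0 subr_eq0 (negPf sl).
have fi0 : `|f i0 0| ^+ 2 = 1.
  rewrite -f1 (bigD1 i0) //= big1 ?addr0 // => i /f0 ->.
  by rewrite normr0 expr0n.
have dotE : `|\sum_i (phi i 0)^* * g i 0| ^+ 2 = `|y i0 0| ^+ 2.
  have -> : \sum_i (phi i 0)^* * g i 0 = (phi^t* *m g) 0 0.
    by rewrite mxE; apply: eq_bigr => i _; rewrite !mxE.
  have ft i : (f^t* ) 0 i = (f i 0)^* by rewrite [LHS]mxE [in LHS]mxE.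
  rewrite -(unitary_dot _ _ Uunitary) -/f -/y mxE (bigD1 i0) //= big1 => [|i /f0 fi].
    by rewrite addr0 ft normrM exprMn norm_conjC fi0 mul1r.
  by rewrite ft fi conjC0 mul0r.
have normU (z : 'cV[C]_n.+1) : \sum_i `|z i 0| ^+ 2 = \sum_i `|(U *m z) i 0| ^+ 2.
  by rewrite !sum_norm_sq unitary_dot.
rewrite dotE (normU (A *m g)) (normU g) UA -/y.
rewrite (bigD1 i0) //= diagE si0 normrM exprMn lerD2l.
rewrite [X in _ <= _ * X](bigD1 i0) //= mulrDr.
apply: ler_wpDl; first by rewrite mulr_ge0 ?exprn_ge0.
rewrite mulr_sumr; apply: ler_sum => i /suniq[_ smu].
by rewrite diagE normrM exprMn ler_wpM2r ?exprn_ge0 // lerXn2r ?nnegrE.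
Qed.

(** The normal case applied to the complexification, which is hermitian. The gap [mu < l 0] supplies
    the simplicity of the top eigenvalue. *)
Lemma symmetric_norm_bound (R : rcfType) n (A : 'M[R]_n) (l : nat -> R)
    (mu : R) (phi g : 'cV[R]_n) :
  A^T = A -> char_poly A = \prod_(i < n) ('X - (l i)%:P) ->
  A *m phi = l 0 *: phi -> \sum_i phi i 0 ^+ 2 = 1 -> 0 <= mu ->
  (forall i, (0 < i < n)%N -> `|l i| <= mu) -> mu < l 0 ->
  \sum_i (A *m g) i 0 ^+ 2 <=
    l 0 ^+ 2 * (\sum_i phi i 0 * g i 0) ^+ 2 + mu ^+ 2 * \sum_i g i 0 ^+ 2.
Proof.
move=> Asym charA Aphi phi1 mu0 lmu mul0.
pose c : {rmorphism R -> complex R} := real_complex R; pose cm m n' (B : 'M[R]_(m, n')) := map_mx c B.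
have cle x y : (c x <= c y) = (x <= y) by exact: lecR.
have creal x : c x \is Num.real by apply/complex_realP; exists x.
have cconj x : (c x)^* = c x by apply/CrealP.
have csq x : `|c x| ^+ 2 = c (x ^+ 2) by rewrite real_normK // rmorphXn.
have cmsum (z : 'cV[R]_n) : \sum_i `|cm _ _ z i 0| ^+ 2 = c (\sum_i z i 0 ^+ 2).
  by rewrite rmorph_sum; apply: eq_bigr => i _; rewrite mxE csq.
have Areal : cm _ _ A \is a realmx by apply/mxOverP => i j; rewrite mxE.
have Anormal : cm _ _ A \is normalmx.
  apply: symmetric_normalmx => //; apply/is_hermitianmxP.
  by rewrite expr0 scale1r map_mx_id // map_trmx Asym.
have := @normal_norm_bound _ n (cm _ _ A) (c \o l) (c mu) (cm _ _ phi) (cm _ _ g) Anormal.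
have -> : \sum_i (cm _ _ phi i 0)^* * cm _ _ g i 0 = c (\sum_i phi i 0 * g i 0).
  by rewrite rmorph_sum; apply: eq_bigr => i _; rewrite !mxE cconj rmorphM.
rewrite -(map_mxM c A g) !cmsum !csq -!rmorphM -rmorphXn -rmorphM -rmorphD !cle.
apply.
- rewrite -map_char_poly charA rmorph_prod; apply: eq_bigr => i _.
  by rewrite rmorphB /= map_polyX map_polyC.
- by rewrite -map_mxM Aphi map_mxZ.
- by rewrite phi1 rmorph1.
- by [].
- move=> i hi; have := lmu i hi.
  rewrite -(@ler_pXn2r _ 2) ?nnegrE ?normr_ge0 //.
  rewrite real_normK ?num_real // => h.
  by rewrite -(@ler_pXn2r _ 2) ?nnegrE ?normr_ge0 -?(rmorph0 c) ?cle // csq -rmorphXn cle.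
move=> i hi; apply/eqP => /complexI li; have := lmu i hi; rewrite li => h.
by have := lt_le_trans mul0 (le_trans (ler_norm _) h); rewrite ltxx.
Qed.

Local Close Scope sesquilinear_scope.

(** * Substochastic matrices and convergence of the expected killing time *)

Lemma exp_mxS (R : pzRingType) n (Q : 'M[R]_n) t : Q ^+ t.+1 = Q ^+ t *m Q.
Proof. by rewrite exprSr. Qed.

Lemma exp_mxD (R : pzRingType) n (Q : 'M[R]_n) s t : Q ^+ (s + t) = Q ^+ s *m Q ^+ t.
Proof. by rewrite exprD. Qed.

Lemma exp_mx_ge0 (R : numDomainType) n (Q : 'M[R]_n) t :
  (forall i j, 0 <= Q i j) -> forall i j, 0 <= (Q ^+ t) i j.
Proof.
move=> Q0; elim: t => [|t IH] i j; first by rewrite expr0 mxE ler0n.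
by rewrite exp_mxS mxE sumr_ge0 // => l _; rewrite mulr_ge0.
Qed.

Section Substochastic.
Variables (R : realType) (n : nat) (Q : 'M[R]_n) (g : 'cV[R]_n).
Hypothesis Q0 : forall i j, 0 <= Q i j.
Hypothesis Q1 : forall i, (Q *m const_mx 1) i (0 : 'I_1) <= 1 :> R.
Hypothesis gE : g = const_mx 1 + Q *m g.

(** A survival probability: for [Q = trans_avoid R e v], the chance that the walk from [i] is not at
    [v] at any of the times 1 to [t]. *)
Let s t i : R := (Q ^+ t *m const_mx 1) i (0 : 'I_1).
Let G : R := \sum_i `|g i 0|.

Let s_ge0 t i : 0 <= s t i.
Proof.
by rewrite /s mxE sumr_ge0 // => j _; rewrite mulr_ge0 ?exp_mx_ge0 // mxE.
Qed.

Let sSr t i : s t.+1 i <= s t i.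
Proof.
rewrite /s exp_mxS -mulmxA !mxE; apply: ler_sum => j _.
by rewrite ler_wpM2l ?exp_mx_ge0 // [leRHS]mxE.
Qed.

Let s_le t u i : (t <= u)%N -> s u i <= s t i.
Proof.
move=> /subnK <-; elim: (u - t)%N => // d IH.
by rewrite addSn (le_trans (sSr _ _)).
Qed.

Let G_ge0 : 0 <= G. Proof. exact: sumr_ge0. Qed.

Let g_le i : `|g i 0| <= G.
Proof. by rewrite /G (bigD1 i) //= lerDl sumr_ge0. Qed.

Let mulQ_le t (x : 'cV[R]_n) (c : R) i : (forall j, `|x j 0| <= c) ->
  `|(Q ^+ t *m x) i 0| <= c * s t i.
Proof.
move=> xc; rewrite mxE (le_trans (ler_norm_sum _ _ _)) //.
rewrite /s mxE mulr_sumr; apply: ler_sum => j _.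
by rewrite ?mxE mulr1 normrM (ger0_norm (exp_mx_ge0 _ _ _ _)) // mulrC ler_wpM2r ?exp_mx_ge0.
Qed.

Lemma hitting_decomp t i : g i 0 = \sum_(u < t) s u i + (Q ^+ t *m g) i 0.
Proof.
elim: t => [|t ->]; first by rewrite big_ord0 add0r expr0 mul1mx.
by rewrite big_ord_recr /= -addrA; congr (_ + _); rewrite {1}gE mulmxDr mulmxA -exp_mxS mxE.
Qed.

Let s0 i : s 0 i = 1. Proof. by rewrite /s expr0 mul1mx mxE. Qed.

(** The partial sums of [s] are bounded because [g] is finite, and [s] is nonincreasing in [t]. *)
Let s_inv t i : t%:R * s t i <= 2 * G.
Proof.
have sum_le : \sum_(u < t) s u i <= 2 * G.
  have -> : \sum_(u < t) s u i = g i 0 - (Q ^+ t *m g) i 0.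
    by rewrite (hitting_decomp t i) addrK.
  rewrite mulr_natl mulr2n (le_trans (ler_norm _)) // (le_trans (ler_normB _ _)) //.
  rewrite lerD ?g_le // (le_trans (mulQ_le _ _ g_le)) //.
  by rewrite ler_piMr // -[leRHS](s0 i) s_le.
apply: le_trans sum_le; rewrite mulr_natl -[X in _ *+ X]card_ord -sumr_const.
by apply: ler_sum => u _; rewrite s_le // ltnW.
Qed.

(** Uses [s_inv] twice: first for the last [b] steps, from each state reached after [a] steps, then
    for the first [a] steps. *)
Let s_mul a b i : a%:R * b%:R * s (a + b) i <= 4 * G ^+ 2.
Proof.
have sab : b%:R * s (a + b) i <= 2 * G * s a i.
  rewrite /s exp_mxD -mulmxA [X in _ * X]mxE mulr_sumr [in leRHS]mxE mulr_sumr.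
  apply: ler_sum => j _; rewrite mulrCA [leRHS]mulrCA ler_wpM2l ?exp_mx_ge0 //.
  by rewrite [in leRHS]mxE mulr1; exact: s_inv.
have := ler_wpM2l (ler0n R a) sab; rewrite mulrA => /le_trans; apply.
rewrite mulrCA (le_trans (ler_wpM2l _ (s_inv a i))) ?mulr_ge0 //.
by rewrite expr2; nra.
Qed.

(** Splitting [t] into nearly equal halves gives quadratic decay of [s]. The linear decay of [s_inv]
    would not force [t%:R * s t i] to 0. *)
Let s_quad t i : t%:R * (t%:R - 1) * s t i <= 16 * G ^+ 2.
Proof.
have [a [b [-> ab1 ab2]]] : exists a b, [/\ t = a + b, a <= b & b <= a.+1]%N.
  by exists t./2, (uphalf t); rewrite uphalf_half; split; have := odd_double_half t; case: (odd t) => /=; lia.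
have := s_mul a b i; have := s_ge0 (a + b) i.
have {ab1}: a%:R <= b%:R :> R by rewrite ler_nat.
have {ab2}: b%:R <= a%:R + 1 :> R by rewrite natr1 ler_nat.
rewrite natrD; set x : R := a%:R; set y : R := b%:R; set z := s _ _.
move=> yx xy z0 h; have x0 : 0 <= x by exact: ler0n.
have d0 : 0 <= (y - x) * (x + 1 - y) by rewrite mulr_ge0 // subr_ge0.
have : (x + y) * (x + y - 1) <= 4 * (x * y) by lra.
by move=> /(ler_wpM2r z0); lra.
Qed.

(** Summation by parts turns the partial sums into [g] minus two boundary terms, both of which
    vanish in the limit by [s_quad]. *)
Lemma expected_time_cvg i (hit : nat -> R) :
  (forall t, hit t.+1 = s t i - s t.+1 i) ->
  (fun T => \sum_(0 <= t < T) t%:R * hit t) @ \oo --> g i 0.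
Proof.
move=> hitE.
have sumE T : \sum_(0 <= t < T.+1) t%:R * hit t =
    g i 0 - (Q ^+ T *m g) i 0 - T%:R * s T i.
  have -> : g i 0 - (Q ^+ T *m g) i 0 = \sum_(u < T) s u i.
    by rewrite (hitting_decomp T i) addrK.
  elim: T => [|T IH]; first by rewrite big_nat1 big_ord0 !mul0r subr0.
  by rewrite big_nat_recr //= IH hitE big_ord_recr /= -natr1; ring.
pose K := 16 * G ^+ 2 * (1 + G).
have K0 : 0 <= K by rewrite !mulr_ge0 ?addr_ge0 ?exprn_ge0.
(* The shift by 3 makes [T.+2] the last time summed, so that the factors in [s_quad] are [T.+2] and
   [T.+1], both positive. *)
have bnd T : `|g i 0 - \sum_(0 <= t < T + 3) t%:R * hit t| <= K * harmonic T.
  rewrite addnS sumE -addrA opprD addNKr opprD !opprK.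
  have T1 : 0 < T.+1%:R :> R by rewrite ltr0n.
  rewrite /harmonic /= ler_pdivlMr //.
  rewrite (@le_trans _ _ ((G + T.+2%:R) * s T.+2 i * T.+1%:R)) //.
    rewrite ler_wpM2r // addn2 (le_trans (ler_normD _ _)) // (mulrDl G) lerD ?mulQ_le //.
    by rewrite ger0_norm ?mulr_ge0.
  have := s_quad T.+2 i; have := s_ge0 T.+2 i.
  rewrite -[T.+2%:R]natr1 addrK /K; move: (s _ _) T1 => z.
  set x : R := T.+1%:R => x0 z0 h.
  have : (G + (x + 1)) <= (1 + G) * (x + 1) by have := G_ge0; nra.
  move=> /(ler_wpM2r z0)/(ler_wpM2r (ltW x0)) /le_trans; apply.
  have := ler_wpM2r (addr_ge0 ler01 G_ge0) h; lra.
rewrite -(@cvg_shiftn 3 R^o).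
apply/cvgrPdist_le => e e0.
have /cvgrPdist_le/(_ e e0) : (fun T => K * harmonic T) @ \oo --> K * 0.
  by apply: cvgMr; exact: cvg_harmonic.
rewrite mulr0; apply: filterS => T.
rewrite sub0r normrN (ger0_norm (mulr_ge0 K0 (harmonic_ge0 _))) => h.
exact: le_trans (bnd T) h.
Qed.

End Substochastic.

(** * Hitting times as solutions of the one-step equations *)

Section HittingTime.
Variables (R : realType) (n : nat) (e : rel 'I_n).
Hypothesis deg_gt0 : forall v, (0 < deg e v)%N.

Lemma trans_ge0 i j : 0 <= trans R e i j.
Proof. by rewrite mxE; case: ifP. Qed.

Lemma trans_row i : \sum_j trans R e i j = 1.
Proof.
under eq_bigr do rewrite mxE; rewrite -big_mkcond /= sumr_const /deg /nbhd.
rewrite -[X in _ *+ X]cardsE -[_ *+ _]mulr_natr mulVf // pnatr_eq0 -lt0n.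
exact: deg_gt0.
Qed.

Lemma hitting_time_harmonic v (h : 'I_n -> R) :
  h v = 0 -> (forall i, i != v -> h i = 1 + \sum_j trans R e i j * h j) ->
  forall w, w != v -> hitting_time R e w v = (h w)%:E.
Proof.
move=> hv hE w wv.
pose Q := trans_avoid R e v.
(* [h] fails the one-step equation at [v] itself. Replacing its value there by one more step repairs
   this, and [Q] does not see the change because its column [v] is zero. *)
pose g : 'cV[R]_n := const_mx 1 + Q *m \col_i h i.
have QE (x y : 'cV[R]_n) : (forall i, i != v -> x i 0 = y i 0) -> Q *m x = Q *m y.
  move=> xy; apply/colP => i; rewrite !mxE; apply: eq_bigr => j _; rewrite !mxE.
  by case: (eqVneq j v) => [_|/xy ->//]; rewrite !mul0r.
have gh i : i != v -> g i 0 = h i.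
  move=> iv; rewrite (hE i iv) !mxE; congr (_ + _); apply: eq_bigr => j _.
  by rewrite !mxE; case: eqP => [->|//]; rewrite hv !mulr0.
have gE : g = const_mx 1 + Q *m g.
  by rewrite {1}/g; congr (_ + _); apply: QE => i iv; rewrite gh // mxE.
have Q0 i j : 0 <= Q i j by rewrite mxE; case: ifP => // _; exact: trans_ge0.
have Qone i : (Q *m const_mx 1) i (0 : 'I_1) = 1 - trans R e i v.
  transitivity (\sum_(j | j != v) trans R e i j); last first.
    by rewrite -(trans_row i) [in RHS](bigD1 v) //= addrAC subrr add0r.
  rewrite mxE (bigD1 v) //= [Q i v]mxE eqxx mul0r add0r; apply: eq_bigr => j jv.
  by rewrite [const_mx _ _ _]mxE mulr1 [LHS]mxE (negPf jv).
have Q1 i : (Q *m const_mx 1) i (0 : 'I_1) <= 1 :> R.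
  by rewrite Qone gerBl trans_ge0.
have hitE t : hit_at R e w v t.+1 =
    (Q ^+ t *m const_mx 1) w (0 : 'I_1) - (Q ^+ t.+1 *m const_mx 1) w (0 : 'I_1).
  rewrite /hit_at -/Q exp_mxS -mulmxA [LHS]mxE [X in _ = X - _]mxE [X in _ = _ - X]mxE -sumrB; apply: eq_bigr => j _.
  by rewrite Qone [const_mx _ _ _]mxE -mulrBr opprB addrC subrK.
have := expected_time_cvg Q0 Q1 gE hitE; rewrite gh // => cv.
rewrite /hitting_time; apply/cvg_lim => //.
under eq_fun do rewrite sumEFin.
apply: cvg_EFin; first exact: nearW.
exact: cv.
Qed.

End HittingTime.

(** * Squared Euclidean norm and the handshake identity *)

Definition normsq (R : realType) n (x : 'cV[R]_n) : R := \sum_i x i 0 ^+ 2.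

Lemma normsq_ge0 (R : realType) n (x : 'cV[R]_n) : 0 <= normsq x.
Proof. by apply: sumr_ge0 => i _; rewrite sqr_ge0. Qed.

Lemma normsq_entry (R : realType) n (x : 'cV[R]_n) i : x i 0 ^+ 2 <= normsq x.
Proof. by rewrite /normsq (bigD1 i) //= lerDl sumr_ge0 // => j _; rewrite sqr_ge0. Qed.

Lemma normsq_eq0 (R : realType) n (x : 'cV[R]_n) : normsq x <= 0 -> x = 0.
Proof.
move=> x0; apply/colP => i; rewrite mxE; apply/eqP; rewrite -sqrf_eq0.
by rewrite eq_le sqr_ge0 (le_trans (normsq_entry x i)).
Qed.

Lemma normsqD (R : realType) n (x y : 'cV[R]_n) :
  normsq (x + y) <= 2 * normsq x + 2 * normsq y.
Proof.
rewrite /normsq !mulr_sumr -big_split /=; apply: ler_sum => i _; rewrite mxE.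
by have := sqr_ge0 (x i 0 - y i 0); nra.
Qed.

(** By symmetry the adjacent pairs below the diagonal are as many as those above it, and
    irreflexivity leaves none on it. *)
Lemma sum_deg n (e : rel 'I_n) :
  simple_graph e -> (\sum_v deg e v = 2 * num_edges e)%N.
Proof.
move=> [esym eirr].
have degE v : deg e v = (\sum_(j | e v j) 1)%N.
  by rewrite sum1_card /deg /nbhd cardsE.
have edgesE : num_edges e = (\sum_i \sum_(j | e i j && (i < j)%N) 1)%N.
  by rewrite /num_edges cardsE -sum1_card pair_big_dep.
have edgesE' : num_edges e = (\sum_i \sum_(j | e i j && (j < i)%N) 1)%N.
  rewrite edgesE (exchange_big_dep xpredT) //=; apply: eq_bigr => i _.
  by apply: eq_bigl => j; rewrite esym.
rewrite mul2n -addnn {1}edgesE edgesE' -big_split; apply: eq_bigr => i _.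
rewrite degE (bigID (fun j : 'I_n => (i < j)%N)) /=; congr (_ + _)%N.
apply: eq_bigl => j; case: (ltngtP i j) => //= /val_inj->.
by rewrite (negPf (eirr _)).
Qed.

(** * Truncated fundamental-matrix formula under a contraction hypothesis *)

Section Walk.
Variables (R : realType) (n : nat) (e : rel 'I_n).
Hypothesis egraph : simple_graph e.
Hypothesis deg_gt0 : forall v, (0 < deg e v)%N.

Let P : 'M[R]_n := trans R e.
Let d : 'rV[R]_n := \row_i (deg e i)%:R.
Let one : 'cV[R]_n := const_mx 1.
Let S : R := \sum_i (deg e i)%:R.

Lemma mul_trans_one : P *m one = one.
Proof.
apply/colP => i; rewrite mxE [RHS]mxE -(trans_row R deg_gt0 i).
by apply: eq_bigr => j _; rewrite [one _ _]mxE mulr1.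
Qed.

Lemma mul_deg_trans : d *m P = d.
Proof.
apply/rowP => j; rewrite mxE [RHS]mxE.
rewrite (eq_bigr (fun i => if e j i then 1 else 0)) => [|i _].
  by rewrite -big_mkcond /= sumr_const /deg /nbhd cardsE.
rewrite !mxE egraph.1; case: ifP => _; rewrite ?mulr0 // mulfV //.
by rewrite pnatr_eq0 -lt0n.
Qed.

Lemma mul_deg_transX t : d *m P ^+ t = d.
Proof.
by elim: t => [|t IH]; rewrite ?expr0 ?mulmx1 // exp_mxS mulmxA IH mul_deg_trans.
Qed.

Lemma mul_transX_one t : P ^+ t *m one = one.
Proof.
by elim: t => [|t IH]; rewrite ?expr0 ?mul1mx // exp_mxS -mulmxA mul_trans_one.
Qed.

Variable rho : R.
Hypothesis rho0 : 0 <= rho.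
Hypothesis rho1 : rho <= 4^-1.
Hypothesis contract : forall g : 'cV[R]_n, d *m g = 0 ->
  normsq (P *m g) <= rho * normsq g.

Lemma normsq_transX (g : 'cV[R]_n) t : d *m g = 0 ->
  normsq (P ^+ t *m g) <= rho ^+ t * normsq g.
Proof.
move=> dg; elim: t => [|t IH]; first by rewrite !expr0 mul1mx mul1r.
rewrite exprS -mulmxA exprS -mulrA.
apply: (le_trans (contract _)); first by rewrite mulmxA mul_deg_transX.
by rewrite ler_wpM2l.
Qed.

(** [normsqD] and the contraction give [normsq x <= 2 * normsq r + 2 * rho * normsq x], and
    [2 * rho] is at most 1/2. *)
Lemma fixpoint_bound (x r : 'cV[R]_n) : d *m x = 0 -> x = r + P *m x ->
  normsq x <= 4 * normsq r.
Proof.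
move=> dx xE; have := normsqD r (P *m x); rewrite -xE.
have := contract dx; have := normsq_ge0 x; have := normsq_ge0 r.
move: (normsq x) (normsq r) (normsq _) => X Y Z Y0 X0 h1 h2.
have : rho * X <= 4^-1 * X by rewrite ler_wpM2r.
lra.
Qed.

Variable v : 'I_n.

Lemma sum_deg_gt0 : 0 < S.
Proof.
rewrite /S (bigD1 v) //= ltr_wpDr ?ltr0n ?deg_gt0 //.
by apply: sumr_ge0 => i _; rewrite ler0n.
Qed.

(* [1 - P + one d / S] is the inverse of the fundamental matrix of the walk. *)
Lemma fixpoint_exists (r : 'cV[R]_n) : d *m r = 0 ->
  exists2 x : 'cV[R]_n, d *m x = 0 & x = r + P *m x.
Proof.
move=> dr.
have d_one : d *m one = S%:M.
  apply/matrixP => i j; rewrite !ord1 mxE [RHS]mxE eqxx mulr1n.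
  by apply: eq_bigr => l _; rewrite !mxE mulr1.
pose F : 'M[R]_n := 1%:M - P + S^-1 *: (one *m d).
have dF x : d *m (F *m x) = d *m x :> 'cV_1.
  rewrite mulmxA mulmxDr mulmxBr mulmx1 mul_deg_trans subrr add0r.
  rewrite -scalemxAr mulmxA d_one mul_scalar_mx scalerA mulVf ?scale1r //.
  by rewrite gt_eqF // sum_deg_gt0.
have FE (x : 'cV_n) : d *m x = 0 -> F *m x = x - P *m x.
  by move=> dx; rewrite mulmxDl mulmxBl mul1mx -scalemxAl -mulmxA dx mulmx0 scaler0 addr0.
(* A kernel vector of [F] is orthogonal to [d] and fixed by [P], so [fixpoint_bound] with zero
   residual kills it. *)
have Funit : F \in unitmx.
  rewrite -unitmx_tr -row_free_unit; apply: inj_row_free => y.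
  move=> /(congr1 trmx); rewrite trmx_mul trmxK trmx0 => Fy.
  have dy : d *m y^T = 0 by rewrite -dF Fy mulmx0.
  have yE : y^T = 0 + P *m y^T.
    by have := FE _ dy; rewrite Fy add0r => /esym/eqP; rewrite subr_eq0 => /eqP.
  have := fixpoint_bound dy yE; rewrite {2}/normsq big1 => [|i _]; last by rewrite mxE expr0n.
  by rewrite mulr0 => /normsq_eq0 /(congr1 trmx); rewrite trmxK trmx0.
have Fx : F *m (invmx F *m r) = r by rewrite mulKVmx.
have dx : d *m (invmx F *m r) = 0 by rewrite -dF Fx.
exists (invmx F *m r) => //.
by rewrite -{2}Fx FE // subrK.
Qed.

Let a : R := S / (deg e v)%:R.
Let dirac : 'cV[R]_n := delta_mx v 0.

Let d_neq0 : (deg e v)%:R != 0 :> R.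
Proof. by rewrite pnatr_eq0 -lt0n. Qed.

Let mul_dirac t i : (P ^+ t *m dirac) i 0 = walk_prob R e t i v.
Proof. by rewrite -colE mxE. Qed.

Let residual0 : 'cV[R]_n := one - a *: dirac.

(** [a] is the reciprocal of the stationary mass of [v], which is exactly the weight that balances
    [one] against [dirac]. *)
Lemma deg_residual0 : d *m residual0 = 0.
Proof.
rewrite mulmxBr -scalemxAr -colE; apply/matrixP => i j; rewrite !ord1 !mxE.
rewrite (eq_bigr (fun i => (deg e i)%:R)) => [|l _]; last by rewrite !mxE mulr1.
by rewrite divfK // subrr.
Qed.

Lemma walk_probS t i :
  walk_prob R e t.+1 i v = \sum_j P i j * walk_prob R e t j v.
Proof. by rewrite /walk_prob exprS mxE. Qed.

(** The first step from [v] is uniform on its neighbours, so the neighbourhood average is a return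
    probability one step later. *)
Lemma nbhd_average t :
  (deg e v)%:R^-1 * \sum_(u in nbhd e v) walk_prob R e t u v = walk_prob R e t.+1 v v.
Proof.
rewrite walk_probS mulr_sumr [LHS]big_mkcond; apply: eq_bigr => u _ /=.
by rewrite /P mxE inE; case: ifP => // _; rewrite mul0r.
Qed.

Lemma walk_prob0 i : walk_prob R e 0 i v = (i == v)%:R.
Proof. by rewrite /walk_prob expr0 mxE. Qed.

Lemma walk_prob1 : walk_prob R e 1 v v = 0.
Proof. by rewrite /walk_prob expr1 mxE (negPf (egraph.2 v)). Qed.

Lemma hitting_time_approx N w : (0 < N)%N -> w != v ->
  exists h : R, hitting_time R e w v = h%:E /\
    (h - (a - 1 + a * ((deg e v)%:R^-1 * \sum_(u in nbhd e v)
            \sum_(1 <= i < N) (walk_prob R e i u v - walk_prob R e i w v)))) ^+ 2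
      <= 27 * (rho ^+ N * normsq residual0).
Proof.
move=> N0 wv.
pose W t i := walk_prob R e t i v.
pose r := P ^+ N *m residual0.
have dr : d *m r = 0 by rewrite mulmxA mul_deg_transX deg_residual0.
have rE i : r i 0 = 1 - a * W N i.
  rewrite /r mulmxBr mul_transX_one -scalemxAr /W -mul_dirac.
  by rewrite !mxE.
have [x dx xE] := fixpoint_exists dr.
pose c := a * \sum_(0 <= t < N) W t v - x v 0.
(* The candidate hitting time: the truncated Green sum, the correction [x], and the constant [c]
   chosen so that [h v = 0]. *)
pose h i := c - a * \sum_(0 <= t < N) W t i + x i 0.
have hv : h v = 0 by rewrite /h /c; ring.
have Ph i : \sum_j P i j * h j = c - a * \sum_(0 <= t < N) W t.+1 i + (x i 0 - r i 0).
  have -> : x i 0 - r i 0 = \sum_j P i j * x j 0.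
    have := congr1 (fun y : 'cV_n => y i 0) xE; rewrite [RHS]mxE [X in _ + X]mxE.
    by move/eqP; rewrite addrC -subr_eq => /eqP.
  have -> : \sum_(0 <= t < N) W t.+1 i = \sum_j P i j * \sum_(0 <= t < N) W t j.
    under eq_bigr do rewrite /W walk_probS; rewrite exchange_big /=.
    by apply: eq_bigr => j _; rewrite mulr_sumr.
  rewrite -[c in RHS]mul1r -(trans_row R deg_gt0 i) mulr_suml mulr_sumr -sumrB -big_split /=.
  by apply: eq_bigr => j _; rewrite /h /P; ring.
(* Applying [P] shifts the sum by one step, so the difference telescopes to [a * (W N i - W 0 i)].
   Here [W 0 i = 0], and [r i 0 = 1 - a * W N i] absorbs the other end. *)
have hE i : i != v -> h i = 1 + \sum_j P i j * h j.
  move=> iv; have := telescope_sumr (W^~ i) (leq0n N).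
  rewrite sumrB Ph /h rE /W walk_prob0 (negPf iv) subr0.
  by move=> /(congr1 (fun y => a * y)); rewrite mulrBr; lra.
exists (h w); split; first exact: (hitting_time_harmonic deg_gt0 hv hE wv).
have -> : (deg e v)%:R^-1 * \sum_(u in nbhd e v) \sum_(1 <= i < N)
    (walk_prob R e i u v - walk_prob R e i w v) =
    \sum_(1 <= i < N) W i.+1 v - \sum_(1 <= i < N) W i w.
  rewrite exchange_big /= mulr_sumr -sumrB; apply: eq_bigr => t _.
  rewrite sumrB mulrBr nbhd_average sumr_const -/(deg e v) -[walk_prob _ _ _ _ _ *+ _]mulr_natl.
  by rewrite mulrA mulVf // mul1r.
(* The return sums differ by one time shift and telescope to [W 1 v - W N v]. Absence of loops gives
   [W 1 v = 0], and [1 - a * W N v] is [r v 0]. *)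
have hw : h w - (a - 1 + a * (\sum_(1 <= i < N) W i.+1 v - \sum_(1 <= i < N) W i w))
    = x w 0 - x v 0 + r v 0.
  rewrite /h /c rE !(big_ltn N0) /W !walk_prob0 eqxx (negPf wv).
  have := telescope_sumr (W^~ v) N0; rewrite sumrB /= /W walk_prob1 subr0.
  by move=> /(congr1 (fun y => a * y)); rewrite mulrBr; lra.
rewrite hw.
have := fixpoint_bound dx xE; have := normsq_transX N deg_residual0; rewrite -/r.
have := normsq_entry x w; have := normsq_entry x v; have := normsq_entry r v.
move: (normsq _) (normsq x) (normsq r) => r0 X Y.
move: (x w 0) (x v 0) (r v 0) => y z t h1 h2 h3 h4 h5.
(* With two entries of [x] at cost 4 each and one of [r] at cost 1, the constant is 3 * (4 + 4 + 1)
   = 27. *)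
have : (y - z + t) ^+ 2 <= 3 * (y ^+ 2 + z ^+ 2 + t ^+ 2).
  by have := sqr_ge0 (y + z); have := sqr_ge0 (y - t); have := sqr_ge0 (z + t); nra.
lra.
Qed.
End Walk.

(** * Contraction of the transition matrix off the degree vector *)

Lemma cauchy_schwarz_sum (R : realFieldType) (I : finType) (x y : I -> R) :
  (\sum_i x i * y i) ^+ 2 <= (\sum_i x i ^+ 2) * (\sum_i y i ^+ 2).
Proof.
have sqE a b : \sum_i (a * y i - b * x i) ^+ 2 = a ^+ 2 * (\sum_i y i ^+ 2)
    - 2 * a * b * (\sum_i x i * y i) + b ^+ 2 * (\sum_i x i ^+ 2).
  by rewrite !mulr_sumr -sumrB -big_split /=; apply: eq_bigr => i _; ring.
set X := \sum_i x i ^+ 2; set Y := \sum_i y i ^+ 2; set Z := \sum_i x i * y i.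
have X0 : 0 <= X by apply: sumr_ge0 => i _; rewrite sqr_ge0.
have : 0 <= \sum_i (X * y i - Z * x i) ^+ 2 by apply: sumr_ge0 => i _; rewrite sqr_ge0.
have -> : \sum_i (X * y i - Z * x i) ^+ 2 = X * (X * Y - Z ^+ 2).
  by rewrite sqE /X /Y /Z; ring.
move: X0; rewrite le_eqVlt => /orP[/eqP X0 _|X0]; last by rewrite pmulr_rge0 // subr_ge0.
rewrite -X0 mul0r; suff -> : Z = 0 by rewrite expr0n.
apply: big1 => i _; have : x i ^+ 2 <= 0.
  by rewrite X0 /X (bigD1 i) //= lerDl sumr_ge0 // => j _; rewrite sqr_ge0.
move=> x0; have /eqP -> : x i == 0 by rewrite -sqrf_eq0 eq_le x0 sqr_ge0.
by rewrite mul0r.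
Qed.

Lemma adj_sym (R : realType) n (e : rel 'I_n) : simple_graph e -> (adj R e)^T = adj R e.
Proof. by move=> [es _]; apply/matrixP => i j; rewrite !mxE es. Qed.

Lemma trans_adj (R : realType) n (e : rel 'I_n) (g : 'cV[R]_n) i :
  (trans R e *m g) i 0 = (deg e i)%:R^-1 * (adj R e *m g) i 0.
Proof.
rewrite !mxE mulr_sumr; apply: eq_bigr => j _; rewrite !mxE.
by case: (e i j); rewrite ?mul1r ?mul0r ?mulr0.
Qed.

(* For [g] orthogonal to the degree vector, [<phi, g> = <phi - t d, g>] for every
   [t]; the choice [t = 1 / (q sqrt n)] makes [phi - t d] small. *)
Lemma trans_contraction (R : realType) n (e : rel 'I_n) (l : nat -> R)
    (phi : 'cV[R]_n) (q L B C : R) :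
  simple_graph e -> (0 < n)%N -> 0 < q -> 1 <= L -> 0 <= B -> 0 <= C ->
  char_poly (adj R e) = \prod_(i < n) ('X - (l i)%:P) ->
  adj R e *m phi = l 0%N *: phi -> \sum_i phi i 0 ^+ 2 = 1 ->
  (forall i, (0 < i < n)%N -> `|l i| <= C * Num.sqrt q) ->
  C * Num.sqrt q < l 0%N <= 2 * q ->
  (forall v, q / 2 <= (deg e v)%:R) ->
  (forall v, ((deg e v)%:R - q) ^+ 2 <= C ^+ 2 * q * L) ->
  (forall i, (phi i 0 - (Num.sqrt n%:R)^-1) ^+ 2 <= B * L / (q * n%:R)) ->
  forall g : 'cV[R]_n, \row_i (deg e i)%:R *m g = 0 ->
  normsq (trans R e *m g) <= 4 * (8 * (B + C ^+ 2) + C ^+ 2) * (L / q) * normsq g.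
Proof.
move=> eg n0 q0 L1 B0 C0 charA Aphi phi1 lmu /andP[mul0 l0q] degq degL phiB g dg.
have N0 : 0 < n%:R :> R by rewrite ltr0n.
have sq0 : 0 <= C * Num.sqrt q by rewrite mulr_ge0 ?sqrtr_ge0.
have G0 := normsq_ge0 g.
have dg' : \sum_i (deg e i)%:R * g i 0 = 0.
  have := congr1 (fun m : 'cV[R]_1 => m 0 0) dg; rewrite mxE [RHS]mxE => dgE; rewrite -[RHS]dgE.
  by apply: eq_bigr => i _; rewrite mxE.
set s := (Num.sqrt n%:R)^-1 in phiB.
have s2 : s ^+ 2 = n%:R^-1 by rewrite exprVn sqr_sqrtr // ltW.
have phig : (\sum_i phi i 0 * g i 0) ^+ 2 <= 2 * (B + C ^+ 2) * (L / q) * normsq g.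
  have -> : \sum_i phi i 0 * g i 0 = \sum_i (phi i 0 - s / q * (deg e i)%:R) * g i 0.
    have -> : \sum_i (phi i 0 - s / q * (deg e i)%:R) * g i 0 =
        \sum_i phi i 0 * g i 0 - s / q * \sum_i (deg e i)%:R * g i 0.
      by rewrite mulr_sumr -sumrB; apply: eq_bigr => i _; rewrite mulrBl mulrA.
    by rewrite dg' mulr0 subr0.
  apply: (le_trans (cauchy_schwarz_sum _ _)); rewrite ler_wpM2r //.
  have -> : 2 * (B + C ^+ 2) * (L / q) = \sum_(i < n) 2 * (B + C ^+ 2) * (L / q) / n%:R.
    by rewrite sumr_const card_ord -(mulr_natr (_ / _) n) divfK // gt_eqF.
  apply: ler_sum => i _.
  have e1 : phi i 0 - s / q * (deg e i)%:R = (phi i 0 - s) - s * (((deg e i)%:R - q) / q).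
    by field; rewrite gt_eqF.
  have e2 : (s * (((deg e i)%:R - q) / q)) ^+ 2 <= C ^+ 2 * L / (q * n%:R).
    have -> : C ^+ 2 * L / (q * n%:R) = n%:R^-1 * ((C ^+ 2 * q * L) / q ^+ 2).
      by field; rewrite !gt_eqF.
    rewrite exprMn s2 expr_div_n ler_wpM2l ?invr_ge0 ?ler0n // ler_wpM2r //.
    by rewrite invr_ge0 exprn_ge0 // ltW.
  have -> : 2 * (B + C ^+ 2) * (L / q) / n%:R =
      2 * (B * L / (q * n%:R)) + 2 * (C ^+ 2 * L / (q * n%:R)).
    by field; rewrite !gt_eqF.
  rewrite e1; have := phiB i; move: e2.
  move: (_ - s) (s * _) => a b h1 h2.
  by have := sqr_ge0 (a + b); nra.
(* The Perron part costs [l 0 ^+ 2 <= 4 * q ^+ 2] times [phig]; the rest costs [C ^+ 2 * q],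
   enlarged by [L >= 1] to the same order. *)
have Ag : normsq (adj R e *m g) <= (8 * (B + C ^+ 2) + C ^+ 2) * (L * q) * normsq g.
  apply: (le_trans (symmetric_norm_bound g (adj_sym R eg) charA Aphi phi1 sq0 lmu mul0)).
  have l0ge : 0 <= l 0%N by exact: le_trans sq0 (ltW mul0).
  have l0sq : l 0%N ^+ 2 <= 4 * q ^+ 2 by nra.
  apply: (@le_trans _ _ (4 * q ^+ 2 * (2 * (B + C ^+ 2) * (L / q) * normsq g)
      + C ^+ 2 * q * normsq g)).
    rewrite lerD //; last by rewrite exprMn sqr_sqrtr // ltW.
    apply: ler_pM => //; exact: sqr_ge0.
  have -> : 4 * q ^+ 2 * (2 * (B + C ^+ 2) * (L / q) * normsq g) =
      8 * (B + C ^+ 2) * (L * q) * normsq g by field; rewrite gt_eqF.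
  have -> : (8 * (B + C ^+ 2) + C ^+ 2) * (L * q) * normsq g =
      8 * (B + C ^+ 2) * (L * q) * normsq g + C ^+ 2 * (L * q) * normsq g by ring.
  rewrite lerD2l ler_wpM2r // ler_wpM2l ?sqr_ge0 //.
  by rewrite ler_peMl // ltW.
apply: (@le_trans _ _ (4 / q ^+ 2 * normsq (adj R e *m g))).
  rewrite /normsq mulr_sumr; apply: ler_sum => i _.
  rewrite trans_adj exprMn ler_wpM2r ?sqr_ge0 // exprVn.
  have -> : 4 / q ^+ 2 = ((q / 2) ^+ 2)^-1 by field; rewrite gt_eqF.
  have q2 : 0 < q / 2 by rewrite divr_gt0.
  have dq := lt_le_trans q2 (degq i).
  by rewrite lef_pV2 ?posrE ?exprn_gt0 // lerXn2r ?nnegrE // ltW.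
have q4 : 0 <= 4 / q ^+ 2 by rewrite divr_ge0 // exprn_ge0 // ltW.
apply: (le_trans (ler_wpM2l q4 Ag)); rewrite le_eqVlt; apply/orP; left; apply/eqP.
by field; rewrite gt_eqF.
Qed.

(** * Numerical consequences of the class conditions and the final estimate *)

Lemma expected_degree_lb (R : realType) (k n : nat) (p : R) :
  (0 < k)%N -> (0 < n)%N ->
  ln n%:R / powR n%:R ((k%:R - 1) / k%:R) <= p ->
  ln n%:R * powR n%:R k%:R^-1 <= p * n%:R.
Proof.
move=> k0 n0 hp.
have N0 : 0 < n%:R :> R by rewrite ltr0n.
have K0 : k%:R != 0 :> R by rewrite pnatr_eq0 -lt0n.
have nE : powR n%:R ((k%:R - 1) / k%:R) * powR n%:R k%:R^-1 = n%:R :> R.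
  rewrite -powRD; last by apply/implyP => _; rewrite gt_eqF.
  by rewrite mulrBl mul1r mulfV // subrK powRr1 // ltW.
rewrite -{3}nE mulrA ler_wpM2r ?powR_ge0 //.
by rewrite -ler_pdivrMr ?powR_gt0.
Qed.

Lemma dist_half_bounds (R : realFieldType) (x q : R) :
  0 <= q -> `|x - q| <= q / 2 -> q / 2 <= x <= 2 * q.
Proof. by move=> q0; rewrite ler_norml => /andP[h1 h2]; apply/andP; split; lra. Qed.

Lemma sum_deg_ratio (R : realType) n (e : rel 'I_n) (q : R) v :
  0 < q -> (forall u, q / 2 <= (deg e u)%:R <= 2 * q) ->
  (\sum_u (deg e u)%:R) / (deg e v)%:R <= 4 * n%:R :> R.
Proof.
move=> q0 degq; have [dv _] := andP (degq v).
rewrite ler_pdivrMr; last by apply: lt_le_trans dv; rewrite divr_gt0.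
apply: (@le_trans _ _ (n%:R * (2 * q))).
  rewrite mulr_natl -[X in _ *+ X]card_ord -sumr_const.
  by apply: ler_sum => u _; case/andP: (degq u).
have := ler_wpM2l (ler0n R n) dv; lra.
Qed.

Theorem theorem6p2 (R : realType) (k : nat) (hk : (2 <= k)%N)
  (c : R) (hc : 0 < c) (C0 : R) (eps : nat -> R) (heps : eps @ \oo --> 0) :
  exists C : R, exists N0 : nat,
  forall (n : nat) (p : R) (e : rel 'I_n),
    (N0 <= n)%N ->
    ln (n%:R) / powR (n%:R) ((k%:R - 1) / k%:R) <= p ->
    p <= 1 - c * (ln (n%:R) ^+ 4 / n%:R) ->
    simple_graph e ->
    in_class e k C0 eps p ->
    forall v w : 'I_n, v != w ->
    exists h : R,
      hitting_time R e w v = h%:E /\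
      `| h - ( 2 * (num_edges e)%:R / (deg e v)%:R - 1
             + 2 * (num_edges e)%:R / (deg e v)%:R
               * ((#|nbhd e v|)%:R^-1
                  * \sum_(u in nbhd e v) \sum_(1 <= i < (3 * k + 2)%N)
                      (walk_prob R e i u v - walk_prob R e i w v)) ) |
        <= C * (Num.sqrt (ln (n%:R)) / Num.sqrt (p * n%:R)).
Proof.
(* [C0] may have any sign; passing to [C1 >= 1] keeps every bound valid and allows multiplication by
   the constant. *)
pose C1 : R := `|C0| + 1.
have C1ge1 : 1 <= C1 by rewrite lerDr.
have C10 : 0 <= C1 by exact: le_trans ler01 C1ge1.
have C0C1 : C0 <= C1 by rewrite (le_trans (ler_norm _)) // lerDl.
pose B : R := C1 ^+ 2 * k%:R ^+ 2.
pose K : R := 4 * (8 * (B + C1 ^+ 2) + C1 ^+ 2).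
have C1sq1 : 1 <= C1 ^+ 2 by rewrite exprn_ege1.
have B0 : 0 <= B by rewrite mulr_ge0 ?sqr_ge0.
have KC1 : 4 * C1 ^+ 2 <= K by rewrite /K; nra.
have K0 : 0 < K by lra.
pose T : R := 4 * K.
have T0 : 0 < T by rewrite /T; lra.
have /cvgrPdist_le/(_ (2^-1)) := heps; rewrite invr_gt0 ltr0n => /(_ isT)[Ne _ heps2].
exists (Num.sqrt (27 * (34 * K ^+ (2 * k).+1))).
(* The three thresholds ensure [|eps n| <= 1/2], [ln n >= 1] and [n^(1/k) >= T]. *)
exists (maxn Ne (maxn (Num.bound (expR 1 : R)) (Num.bound (T ^+ k)))).
move=> n p e; rewrite !geq_max => /and3P[hNe hn1 hnT] hp _ eg.
case=> _ hdeg _ _ [l [charA lsort [phi [Aphi phi1 hphi]] l0q l1]] v w vw.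
pose q := p * n%:R; rewrite -/q in hdeg l0q l1 *.
set L : R := ln n%:R in hdeg hphi hp *.
have en : expR 1 <= n%:R :> R.
  by rewrite (le_trans (ltW (archi_boundP _))) ?expR_ge0 // ler_nat.
have Tn : T ^+ k <= n%:R.
  by rewrite (le_trans (ltW (archi_boundP _))) ?exprn_ge0 ?ler_nat // ltW.
have N0 : 0 < n%:R :> R by apply: lt_le_trans en; exact: expR_gt0.
have n0 : (0 < n)%N by rewrite -(ltr0n R).
have k0 : (0 < k)%N by apply: leq_trans hk.
have L1 : 1 <= L by rewrite -[1]expRK ler_ln ?posrE ?expR_gt0.
have Lgt0 : 0 < L by exact: lt_le_trans ltr01 L1.
have L0 := ltW Lgt0.
pose m := powR (n%:R : R) k%:R^-1.
have m0 : 0 < m by exact: powR_gt0.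
have mk : m ^+ k = n%:R.
  by rewrite -powR_mulrn ?ltW // -powRrM mulVf ?pnatr_eq0 -?lt0n // powRr1 // ltW.
have Tm : T <= m.
  rewrite leNgt; apply/negP => mT; have : m ^+ k < T ^+ k.
    by rewrite ltrXn2r ?nnegrE ?ltW ?gtn_eqF.
  by rewrite mk ltNge Tn.
have qLm : L * m <= q by exact: expected_degree_lb.
have qm : m <= q by apply: le_trans qLm; rewrite ler_peMl // ltW.
have q0 : 0 < q by exact: lt_le_trans qm.
have q0' := ltW q0.
have p0 : 0 < p by rewrite -(pmulr_lgt0 _ N0).
have p0' := ltW p0.
have qL : T * L <= q by apply: le_trans qLm; rewrite mulrC ler_wpM2l.
have degL u : ((deg e u)%:R - q) ^+ 2 <= C1 ^+ 2 * q * L.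
  rewrite -mulrA -(@sqr_sqrtr _ (q * L)) ?mulr_ge0 //.
  rewrite -exprMn -real_normK ?num_real // lerXn2r ?nnegrE ?mulr_ge0 ?sqrtr_ge0 //.
  by rewrite (le_trans (hdeg u)) // ler_wpM2r ?sqrtr_ge0.
have degq u : q / 2 <= (deg e u)%:R <= 2 * q.
  suff : `|(deg e u)%:R - q| <= q / 2 by move=> /(dist_half_bounds q0').
  (* After squaring, [C1 ^+ 2 * q * L <= q ^+ 2 / 4] is needed; it follows from [4 * K * L <= q] and
     [4 * C1 ^+ 2 <= K]. *)
  rewrite -(@ler_pXn2r _ 2) ?nnegrE ?normr_ge0 ?divr_ge0 //.
  rewrite real_normK ?num_real //; apply: (le_trans (degL u)).
  have := ler_wpM2l q0' qL; have := ler_wpM2r (ltW q0) KC1.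
  by rewrite /T => h; have := ler_wpM2r (le_trans ler01 L1) h; have := sqr_ge0 q; lra.
have deg_gt0 u : (0 < deg e u)%N.
  by have [dq _] := andP (degq u); rewrite -(ltr0n R) (lt_le_trans _ dq) // divr_gt0.
have phiB i : (phi i 0 - (Num.sqrt n%:R)^-1) ^+ 2 <= B * L / (q * n%:R).
  (* As [q >= m = n^(1/k)], the [ln q] in the denominator of the eigenvector condition cancels a
     factor [L] at the cost of [k], which explains the factor [k ^+ 2] in [B]. *)
  have lnq : L / k%:R <= ln q.
    have -> : L / k%:R = ln m by rewrite ln_powR mulrC.
    by rewrite ler_ln ?posrE.
  have k0R : 0 < k%:R :> R by rewrite ltr0n.
  have lnq0 : 0 < ln q by apply: lt_le_trans lnq; rewrite divr_gt0.
  have sp0 : 0 < Num.sqrt p by rewrite sqrtr_gt0.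
  have bound : `|phi i 0 - (Num.sqrt n%:R)^-1| <=
      C1 * k%:R * (Num.sqrt L / (Num.sqrt p * n%:R)).
    apply: (le_trans (hphi i)); rewrite -/q.
    rewrite ler_pdivrMr ?mulr_gt0 //.
    have -> : C1 * k%:R * (Num.sqrt L / (Num.sqrt p * n%:R)) * (Num.sqrt p * n%:R * ln q)
        = C1 * (k%:R * ln q * Num.sqrt L) by field; rewrite !gt_eqF.
    apply: (@le_trans _ _ (C1 * (L * Num.sqrt L))).
      by rewrite ler_wpM2r // mulr_ge0 ?sqrtr_ge0.
    rewrite ler_wpM2l //.
    by rewrite ler_wpM2r ?sqrtr_ge0 // mulrC -ler_pdivrMr.
  have -> : B * L / (q * n%:R) = (C1 * k%:R * (Num.sqrt L / (Num.sqrt p * n%:R))) ^+ 2.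
    rewrite !exprMn exprVn exprMn !sqr_sqrtr  //.
    by rewrite /B /q; field; rewrite !gt_eqF.
  rewrite -real_normK ?num_real // lerXn2r ?nnegrE //.
  exact: le_trans bound.
have mu_lt : C1 * Num.sqrt q <= q / 4.
  rewrite -(@ler_pXn2r _ 2) ?nnegrE ?mulr_ge0 ?sqrtr_ge0 ?divr_ge0 //.
  rewrite exprMn sqr_sqrtr //.
  have : 16 * C1 ^+ 2 <= q by rewrite /T in Tm; lra.
  by move=> /(ler_wpM2r (ltW q0)); lra.
have l0bnd : C1 * Num.sqrt q < l 0%N <= 2 * q.
  have hn : `|eps n| <= 2^-1 by have := heps2 n hNe; rewrite /= sub0r normrN.
  have : `|l 0%N - q| <= q / 2.
    apply: (le_trans l0q); rewrite mulrC ler_wpM2l ?(ltW q0) //.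
    exact: le_trans (ler_norm _) hn.
  move=> /(dist_half_bounds q0')/andP[l0 ->]; rewrite andbT (le_lt_trans mu_lt) //.
  by apply: lt_le_trans l0; rewrite ltr_pM2l // ltf_pV2 ?posrE ?ltr_nat.
(* The class bounds only the second and the last eigenvalue; the ordering sandwiches the others
   between them. *)
have lmu i : (0 < i < n)%N -> `|l i| <= C1 * Num.sqrt q.
  move=> /andP[i0 iN].
  have : Num.max `|l 1%N| `|l n.-1| <= C1 * Num.sqrt q.
    by rewrite (le_trans l1) // ler_wpM2r ?sqrtr_ge0.
  rewrite ge_max !ler_norml => /andP[/andP[_ l1u] /andP[ln1 _]].
  have h1 : l i <= l 1%N by apply: lsort; rewrite i0 iN.
  have h2 : l n.-1 <= l i by apply: lsort; rewrite -ltnS prednK ?iN ?leqnn.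
  by rewrite (le_trans ln1 h2) (le_trans h1 l1u).
have degql u : q / 2 <= (deg e u)%:R by case/andP: (degq u).
have contract := trans_contraction eg n0 q0 L1 B0 C10 charA Aphi phi1 lmu l0bnd degql degL phiB.
pose rho := K * (L / q).
have Lq0 : 0 <= L / q by rewrite divr_ge0.
have rho_ge0 : 0 <= rho by rewrite mulr_ge0 // ltW.
have rho_m : rho <= K / m.
  rewrite ler_wpM2l ?(ltW K0) // ler_pdivrMr // mulrC ler_pdivlMr //.
have rho_le : rho <= 4^-1.
  by apply: (le_trans rho_m); rewrite ler_pdivrMr //; rewrite /T in Tm; lra.
have Npos : (0 < 3 * k + 2)%N by rewrite addn2.
have wv : w != v by rewrite eq_sym.
have [h [hit]] := hitting_time_approx eg deg_gt0 rho_ge0 rho_le contract Npos wv.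
have -> : \sum_i (deg e i)%:R = 2 * (num_edges e)%:R :> R.
  by rewrite -natr_sum sum_deg // natrM.
set a := 2 * _ / _; set F := (X in h - X); move=> hE.
exists h; split=> //; rewrite -/F.
have a_le : a <= 4 * n%:R.
  have := @sum_deg_ratio R n e q v q0 degq.
  by rewrite -natr_sum sum_deg // natrM.
have a_ge0 : 0 <= a by rewrite divr_ge0 ?mulr_ge0.
(* The two parts contribute [2 * n] and [2 * a ^+ 2 <= 32 * n ^+ 2]. *)
have res0 : normsq (const_mx 1 - a *: delta_mx v 0 : 'cV[R]_n) <= 34 * n%:R ^+ 2.
  apply: (le_trans (normsqD _ _)).
  have -> : normsq (const_mx 1 : 'cV[R]_n) = n%:R.
    rewrite /normsq (eq_bigr (fun=> 1)) => [|i _]; last by rewrite mxE expr1n.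
    by rewrite sumr_const card_ord.
  have -> : normsq (- (a *: delta_mx v 0) : 'cV[R]_n) = a ^+ 2.
    rewrite /normsq (bigD1 v) //= big1 => [|i iv].
      by rewrite !mxE !eqxx mulr1 sqrrN addr0.
    by rewrite !mxE (negPf iv) mulr0 oppr0 expr0n.
  have n1 : 1 <= n%:R :> R by rewrite (ler_nat _ 1).
  by nra.
have rhoN : rho ^+ (3 * k + 2) * n%:R ^+ 2 <= K ^+ (2 * k).+1 * (L / q).
  (* One factor [rho] yields the rate [L / q], the next [k.+1] are bounded by 1, and the last
     [2 * k] cancel [n ^+ 2] through [rho <= K / m] and [m ^+ k = n]. *)
  have -> : (3 * k + 2 = (1 + k.+1) + 2 * k)%N by clear; lia.
  rewrite 2!exprD expr1.
  have r1 : rho ^+ k.+1 <= 1 by rewrite exprn_ile1 //; lra.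
  have r2 : rho ^+ (2 * k) * n%:R ^+ 2 <= K ^+ (2 * k).
    have -> : K ^+ (2 * k) = (K / m) ^+ (2 * k) * n%:R ^+ 2.
      rewrite -mk -exprM (mulnC k) -exprMn divfK // gt_eqF //.
    by rewrite ler_wpM2r ?sqr_ge0 // lerXn2r ?nnegrE // divr_ge0 // ltW.
  have -> : K ^+ (2 * k).+1 * (L / q) = rho * (1 * K ^+ (2 * k)).
    by rewrite exprS /rho; ring.
  rewrite -2!mulrA ler_wpM2l // ler_pM ?mulr_ge0 ?exprn_ge0 ?sqr_ge0 //.
have bound : (h - F) ^+ 2 <= 27 * (34 * K ^+ (2 * k).+1) * (L / q).
  apply: (le_trans hE); rewrite -mulrA ler_wpM2l //.
  apply: (@le_trans _ _ (rho ^+ (3 * k + 2) * (34 * n%:R ^+ 2))).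
    by rewrite ler_wpM2l ?exprn_ge0.
  by lra.
rewrite -sqrtr_sqr; apply: (le_trans (ler_wsqrtr bound)).
have c0 : 0 <= 27 * (34 * K ^+ (2 * k).+1) by rewrite !mulr_ge0 ?exprn_ge0 // ltW.
rewrite sqrtrM // [Num.sqrt (L / q)]sqrtrM; last by lra.
by rewrite sqrtrV // ltW.
Qed.
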